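(* Let $\hat\alpha=-\alpha$ and $\hat{\boldsymbol\alpha}=-\boldsymbol\alpha$. Then: (i) (in $\mathbb{R}^2$) $\boldsymbol G^{\alpha}(\boldsymbol x,\boldsymbol z)=\boldsymbol G^{\hat\alpha}(\boldsymbol z,\boldsymbol x)$ for all $\boldsymbol x,\boldsymbol z\in\mathbb{R}^2$, $\boldsymbol x\ne\boldsymbol z$; (ii) (quasi-periodic case in $\mathbb{R}^3$) $\widetilde{\boldsymbol G}^{\alpha}(\boldsymbol x,\boldsymbol z)=\widetilde{\boldsymbol G}^{\hat\alpha}(\boldsymbol z,\boldsymbol x)$ for all $\boldsymbol x,\boldsymbol z\in\mathbb{R}^3$, $\boldsymbol x\ne\boldsymbol z$; (iii) (quasi-biperiodic case in $\mathbb{R}^3$) $\mathring{\boldsymbol G}^{\boldsymbol\alpha}(\boldsymbol x,\boldsymbol z)=\mathring{\boldsymbol G}^{\hat{\boldsymbol\alpha}}(\boldsymbol z,\boldsymbol x)$ for all $\boldsymbol x,\boldsymbol z\in\mathbb{R}^3$, $\boldsymbol x\ne\boldsymbol z$. (Here $\boldsymbol x\neq\boldsymbol z$ is understood modulo the lattice of periods, i.e. $\boldsymbol x-\boldsymbol z\notin\mathbb{Z}\times\{0\}$, $\mathbb{Z}\times\{(0,0)\}$, $\mathbb{Z}^2\times\{0\}$ in (i), (ii), (iii) respectively, so that both sides are defined.)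
   Context: $\lambda,\mu\in\mathbb{R}$ with $\mu>0$, $\lambda+\mu>0$; density $1$; $\omega>0$; $k_p=\omega/\sqrt{\lambda+2\mu}$, $k_s=\omega/\sqrt\mu$; $\Delta^*=\mu\Delta+(\lambda+\mu)\nabla\nabla\cdot$. The quasi-periodicity parameters satisfy $0<\alpha\le k_p$, respectively $\boldsymbol\alpha=(\alpha_1,\alpha_2)$ with $\alpha_1,\alpha_2>0$, $|\boldsymbol\alpha|\le k_p$; the Green's functions below are defined by the same formulas for the parameters $-\alpha$, $-\boldsymbol\alpha$. For real $t\geq 0$ and $k>0$ write $\kappa(k,t)=\sqrt{k^2-t}$ if $t\le k^2$ and $\kappa(k,t)=\mathrm{i}\sqrt{t-k^2}$ if $t>k^2$. It is implicitly assumed that no $\kappa$ occurring below vanishes. The quasi-periodic Green's functions of the Lamé system are the outgoing solutions of $(\Delta^*_{\boldsymbol x}+\omega^2)\boldsymbol G^\alpha(\boldsymbol x,\boldsymbol y)=\sum_{n\in\mathbb{Z}}\delta(x_1-y_1-n)\delta(x_2-y_2)e^{\mathrm{i}n\alpha}\boldsymbol I_2$ in $\mathbb{R}^2$; $(\Delta^*_{\boldsymbol x}+\omega^2)\widetilde{\boldsymbol G}^\alpha(\boldsymbol x,\boldsymbol y)=\sum_{n\in\mathbb{Z}}\delta(x_1-y_1-n)\delta(x_2-y_2)\delta(x_3-y_3)e^{\mathrm{i}n\alpha}\boldsymbol I_3$ in $\mathbb{R}^3$; $(\Delta^*_{\boldsymbol x}+\omega^2)\mathring{\boldsymbol G}^{\boldsymbol\alpha}(\boldsymbol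 x,\boldsymbol y)=\sum_{\boldsymbol n\in\mathbb{Z}^2}\delta(x_1-y_1-n_1)\delta(x_2-y_2-n_2)\delta(x_3-y_3)e^{\mathrm{i}\boldsymbol n\cdot\boldsymbol\alpha}\boldsymbol I_3$ in $\mathbb{R}^3$. Explicitly each of them equals $\big[\tfrac1\mu\Phi_{k_s}\boldsymbol I+\tfrac1{\omega^2}\nabla\nabla^\top(\Phi_{k_s}-\Phi_{k_p})\big](\boldsymbol x-\boldsymbol y)$, where, with $\alpha_l=\alpha+l$ and $\boldsymbol\alpha_{\boldsymbol l}=\boldsymbol\alpha+\boldsymbol l$, for $\boldsymbol G^\alpha$: $\Phi_k(\boldsymbol x)=\sum_{l\in2\pi\mathbb{Z}}\frac{1}{2\mathrm{i}\kappa(k,\alpha_l^2)}e^{\mathrm{i}\alpha_lx_1+\mathrm{i}\kappa(k,\alpha_l^2)|x_2|}$; for $\widetilde{\boldsymbol G}^\alpha$: $\Phi_k(\boldsymbol x)=-\frac{\mathrm{i}}4\sum_{l\in2\pi\mathbb{Z}}e^{\mathrm{i}\alpha_lx_1}H_0^{(1)}\big(\kappa(k,\alpha_l^2)\sqrt{x_2^2+x_3^2}\big)$; for $\mathring{\boldsymbol G}^{\boldsymbol\alpha}$: $\Phi_k(\boldsymbol x)=\sum_{\boldsymbol l\in(2\pi\mathbb{Z})^2}\frac{1}{2\mathrm{i}\kappa(k,|\boldsymbol\alpha_{\boldsymbol l}|^2)}e^{\mathrm{i}\boldsymbol\alpha_{\boldsymbol l}\cdot(x_1,x_2)+\mathrm{i}\kappa(k,|\boldsymbol\alpha_{\boldsymbol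 l}|^2)|x_3|}$. The series are understood in the sense of distributions; they define smooth functions away from the lattice of source points. *)

(* Defs.v *)
From HB Require Import structures.
From mathcomp Require Import all_boot all_order all_algebra.
From mathcomp Require Import complex.
From mathcomp Require Import all_classical all_reals all_analysis.
From mathcomp Require Import summability.

Set Implicit Arguments.
Unset Strict Implicit.
Unset Printing Implicit Defensive.
Import Order.TTheory GRing.Theory Num.Theory.
Import numFieldNormedType.Exports.

Local Open Scope classical_set_scope.
Local Open Scope ring_scope.
Local Open Scope complex_scope.

(* Limits of complex sequences are taken in R[i]^o, the copy of R[i] that
   carries the topology of the norm. *)

Definition cexp (R : realType) (z : R[i]) : R[i] :=
  (expR (complex.Re z))%:C *
  (cos (complex.Im z) +i* sin (complex.Im z)).

Definition cmod (R : realType) (z : R[i]) : R :=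
  Num.sqrt (complex.Re z ^+ 2 + complex.Im z ^+ 2).

(* Principal branch, arguments in ]-pi, pi]. *)
Definition carg (R : realType) (z : R[i]) : R :=
  let t := acos (complex.Re z / cmod z) in
  if 0 <= complex.Im z then t else - t.

Definition cln (R : realType) (z : R[i]) : R[i] := ln (cmod z) +i* carg z.

Definition euler_gamma (R : realType) : R :=
  limn (fun n : nat => series harmonic n - ln n%:R : R).

(* J_0(z) = sum_k (-1)^k (z^2/4)^k / (k!)^2 *)
Definition besselJ0 (R : realType) (z : R[i]) : R[i] :=
  limn (series (fun k : nat =>
    (-1) ^+ k * (z ^+ 2 / 4%:R) ^+ k / (k`!)%:R ^+ 2 : R[i]^o)).

(* Y_0(z) = 2/pi (ln(z/2) + gamma) J_0(z)
            + 2/pi sum_k (-1)^(k+1) H_k (z^2/4)^k / (k!)^2,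
   with H_k = 1 + 1/2 + ... + 1/k, which is series harmonic k. *)
Definition besselY0 (R : realType) (z : R[i]) : R[i] :=
  (2 / pi)%:C * (cln (z / 2%:R) + (euler_gamma R)%:C) * besselJ0 z +
  (2 / pi)%:C * limn (series (fun k : nat =>
    (-1) ^+ k.+1 * (series harmonic k : R)%:C * (z ^+ 2 / 4%:R) ^+ k
      / (k`!)%:R ^+ 2 : R[i]^o)).

Definition hankel1_0 (R : realType) (z : R[i]) : R[i] :=
  besselJ0 z + 'i * besselY0 z.

Definition unit_vec (R : realType) (d : nat) (i : 'I_d) : 'rV[R]_d :=
  delta_mx 0 i.

Definition pderiv (R : realType) (d : nat) (i : 'I_d) (f : 'rV[R]_d -> R) :
  'rV[R]_d -> R := 'D_(unit_vec R i) f.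

Definition pderivs (R : realType) (d : nat) (s : seq 'I_d)
  (f : 'rV[R]_d -> R) : 'rV[R]_d -> R := foldr (@pderiv R d) f s.

Definition smooth_on (R : realType) (d : nat) (D : set 'rV[R]_d)
  (f : 'rV[R]_d -> R) : Prop :=
  forall (s : seq 'I_d) (x : 'rV[R]_d), D x ->
    {for x, continuous (pderivs s f)} /\
    forall i : 'I_d, derivable (pderivs s f) x (unit_vec R i).

Definition csmooth_on (R : realType) (d : nat) (D : set 'rV[R]_d)
  (f : 'rV[R]_d -> R[i]) : Prop :=
  smooth_on D (fun x => complex.Re (f x)) /\
  smooth_on D (fun x => complex.Im (f x)).

Definition hessian (R : realType) (d : nat) (f : 'rV[R]_d -> R[i])
  (x : 'rV[R]_d) : 'M[R[i]]_d :=
  \matrix_(i, j) (pderivs [:: i; j] (fun y => complex.Re (f y)) x +i*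
                  pderivs [:: i; j] (fun y => complex.Im (f y)) x).

Definition support_closure (R : realType) (d : nat)
  (f : 'rV[R]_d -> R[i]) : set 'rV[R]_d := closure [set x | f x != 0].

(* The space of test functions C_c^oo(D), for D open. *)
Definition test_function (R : realType) (d : nat) (D : set 'rV[R]_d)
  (f : 'rV[R]_d -> R[i]) : Prop :=
  [/\ csmooth_on setT f, compact (support_closure f) &
      support_closure f `<=` D].

(* Lebesgue integrals over R^2 and R^3, identified with R * R and
   (R * R) * R. *)
Definition integral2 (R : realType) (f : 'rV[R]_2 -> R) : R :=
  \int[(@lebesgue_measure R \x @lebesgue_measure R)%E]_p
    f (\row_(i < 2) [:: p.1; p.2]`_i).

Definition integral3 (R : realType) (f : 'rV[R]_3 -> R) : R :=
  \int[((@lebesgue_measure R \x @lebesgue_measure R)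
          \x @lebesgue_measure R)%E]_p
    f (\row_(i < 3) [:: p.1.1; p.1.2; p.2]`_i).

Definition cintegral (R : realType) (d : nat)
  (integ : ('rV[R]_d -> R) -> R) (f : 'rV[R]_d -> R[i]) : R[i] :=
  integ (fun x => complex.Re (f x)) +i* integ (fun x => complex.Im (f x)).

(* Unconditional convergence: the limit of the finite partial sums along the
   finite subsets of I ordered by inclusion. *)
Definition csums_to (R : realType) (I : choiceType) (a : I -> R[i])
  (s : R[i]) : Prop :=
  partial_sum (a : I -> R[i]^o) @ totally --> (s : R[i]^o).

(* The series of locally integrable functions u converges in the sense of
   distributions on R^d, and the restriction of its sum to the open set D is
   the smooth function Phi. This determines Phi on D; its values outside D
   are irrelevant. *)
Definition distribution_sum (R : realType) (d : nat)
  (integ : ('rV[R]_d -> R) -> R) (I : choiceType)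
  (u : I -> 'rV[R]_d -> R[i]) (D : set 'rV[R]_d)
  (Phi : 'rV[R]_d -> R[i]) : Prop :=
  let pairing (v f : 'rV[R]_d -> R[i]) :=
    cintegral integ (fun x => v x * f x) in
  [/\ forall f, test_function setT f ->
        exists s, csums_to (fun l => pairing (u l) f) s,
      csmooth_on D Phi &
      forall f, test_function D f ->
        csums_to (fun l => pairing (u l) f) (pairing Phi f)].

Definition series_function (R : realType) (d : nat)
  (integ : ('rV[R]_d -> R) -> R) (I : choiceType)
  (u : I -> 'rV[R]_d -> R[i]) (D : set 'rV[R]_d) : 'rV[R]_d -> R[i] :=
  xget (fun=> 0) [set Phi | distribution_sum integ u D Phi].

Definition kappa (R : realType) (k t : R) : R[i] :=
  if t <= k ^+ 2 then (Num.sqrt (k ^+ 2 - t))%:C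
  else 'i * (Num.sqrt (t - k ^+ 2))%:C.

(* The index l in 2 pi Z of the lattice sums is 2 pi n with n : int. *)
Definition alpha_ (R : realType) (alpha : R) (n : int) : R :=
  alpha + 2 * pi * n%:~R.

Definition balpha_ (R : realType) (alpha : 'rV[R]_2) (n : int * int) :
  'rV[R]_2 :=
  \row_(i < 2) [:: alpha_ (alpha 0 0) n.1; alpha_ (alpha 0 1) n.2]`_i.

Definition sqnorm (R : realType) (d : nat) (x : 'rV[R]_d) : R :=
  \sum_i x 0 i ^+ 2.

(* Lattices of source points: Z x {0}, Z x {(0,0)} and Z^2 x {0}. *)
Definition lattice2 (R : realType) : set 'rV[R]_2 :=
  [set x | (exists n : int, x 0 0 = n%:~R) /\ x 0 1 = 0].

Definition lattice3 (R : realType) : set 'rV[R]_3 :=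
  [set x | [/\ exists n : int, x 0 0 = n%:~R, x 0 1 = 0 & x 0 ord_max = 0]].

Definition bilattice3 (R : realType) : set 'rV[R]_3 :=
  [set x | [/\ exists n : int, x 0 0 = n%:~R,
               exists n : int, x 0 1 = n%:~R & x 0 ord_max = 0]].

Definition Phi2 (R : realType) (alpha k : R) : 'rV[R]_2 -> R[i] :=
  series_function (@integral2 R)
    (fun (n : int) (x : 'rV[R]_2) =>
       let kap := kappa k (alpha_ alpha n ^+ 2) in
       (2%:R * 'i * kap)^-1 *
       cexp ('i * (alpha_ alpha n * x 0 0)%:C + 'i * kap * `|x 0 1|%:C))
    (~` @lattice2 R).

Definition Phi3 (R : realType) (alpha k : R) : 'rV[R]_3 -> R[i] :=
  series_function (@integral3 R)
    (fun (n : int) (x : 'rV[R]_3) =>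
       let kap := kappa k (alpha_ alpha n ^+ 2) in
       - ('i / 4%:R) * (cexp ('i * (alpha_ alpha n * x 0 0)%:C) *
         hankel1_0
           (kap * (Num.sqrt (x 0 1 ^+ 2 + x 0 ord_max ^+ 2))%:C)))
    (~` @lattice3 R).

Definition biPhi3 (R : realType) (alpha : 'rV[R]_2) (k : R) :
  'rV[R]_3 -> R[i] :=
  series_function (@integral3 R)
    (fun (n : int * int) (x : 'rV[R]_3) =>
       let a := balpha_ alpha n in
       let kap := kappa k (sqnorm a) in
       (2%:R * 'i * kap)^-1 *
       cexp ('i * (a 0 0 * x 0 0 + a 0 1 * x 0 1)%:C
             + 'i * kap * `|x 0 ord_max|%:C))
    (~` @bilattice3 R).

Definition k_p (R : realType) (lambda mu omega : R) : R :=
  omega / Num.sqrt (lambda + 2 * mu).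

Definition k_s (R : realType) (mu omega : R) : R := omega / Num.sqrt mu.

(* The tensor (1/mu Phi_ks I + 1/omega^2 grad grad^T (Phi_ks - Phi_kp))(x - y)
   built from a family k |-> Phi k of scalar functions. *)
Definition lame_tensor (R : realType) (d : nat) (lambda mu omega : R)
  (Phi : R -> 'rV[R]_d -> R[i]) (x y : 'rV[R]_d) : 'M[R[i]]_d :=
  let kp := k_p lambda mu omega in
  let ks := k_s mu omega in
  ((mu^-1)%:C * Phi ks (x - y))%:M +
  ((omega ^+ 2)^-1)%:C *: hessian (fun z => Phi ks z - Phi kp z) (x - y).

(* Quasi-periodic Green's functions of the Lame system: G^alpha in R^2,
   tilde G^alpha in R^3, and the biperiodic ring G^alpha in R^3. *)
Definition green2 (R : realType) (lambda mu omega alpha : R) :=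
  lame_tensor lambda mu omega (@Phi2 R alpha).

Definition green3 (R : realType) (lambda mu omega alpha : R) :=
  lame_tensor lambda mu omega (@Phi3 R alpha).

Definition bigreen3 (R : realType) (lambda mu omega : R)
  (alpha : 'rV[R]_2) :=
  lame_tensor lambda mu omega (@biPhi3 R alpha).

(* Main.v *)
(* Replacing the summation index l by -l turns the term of index l of the series
   for -alpha into the reflection x |-> -x of the term of index l for alpha. As
   Lebesgue measure is invariant under reflection, y |-> Phi(-y) is a sum of the
   series for -alpha whenever Phi is a sum of the series for alpha. A smooth
   function is determined on an open set by its integrals against bump
   functions, so Phi^{-alpha}(y) = Phi^alpha(-y) off the lattice, and second
   derivatives are unchanged by reflection. If the series has no distributional
   sum, both Phi's are the default value 0, and the identity is trivial.

   The terms of the series and their sum are not known to be measurable as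
   functions on R * R or R * R * R, so reflection and comparison of integrals are
   proved for arbitrary functions: the integral is a supremum over simple
   functions, and smooth functions are only compared with multiples of a
   measurable bump. *)

Require Import Defs.
From mathcomp Require Import all_boot all_order all_algebra complex finmap.
From mathcomp Require Import all_classical all_reals all_analysis.
From mathcomp Require Import measurable_realfun summability ring lra.
Import Order.TTheory GRing.Theory Num.Theory.
Import numFieldNormedType.Exports.
Local Open Scope classical_set_scope.
Local Open Scope ring_scope.

Set Implicit Arguments.
Unset Strict Implicit.
Unset Printing Implicit Defensive.

(** * Partial derivatives and the Hessian under the reflection of space *)

Lemma cvg_growth_rateN (R : realType) (V : normedModType R) (f : V -> R)
    (a v : V) (l : R) :
  h^-1 *: (f (h *: v + a) - f a) @[h --> 0^'] --> l ->
  h^-1 *: (f (h *: - v + a) - f a) @[h --> 0^'] --> - l.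
Proof.
move=> fl; pose F h := h^-1 *: (f (h *: v + a) - f a).
have -> : (fun h => h^-1 *: (f (h *: - v + a) - f a)) = (fun h : R => - F (- h)).
  by apply/funext => h; rewrite /F invrN !scaleNr scalerN opprK.
(* The substitution of [- h] for [h] is legitimate because negation maps the punctured
   neighbourhoods of 0 to themselves. *)
apply: cvgN; apply: (cvg_comp (-%R) F _ fl).
move=> A; rewrite -{1}oppr0 dnbhsN => -[B B0 <-] /=.
rewrite !near_simpl /=; apply: filterS B0 => x Bx; exists x => //.
Qed.

Lemma derivable_oppV (R : realType) (V : normedModType R) (f : V -> R)
    (a v : V) : derivable f a v -> derivable f a (- v).
Proof.
by move=> /cvg_ex[l fl]; apply/cvg_ex; exists (- l); exact: cvg_growth_rateN.
Qed.

Lemma derive_default (R : realType) (V : normedModType R) (f : V -> R)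
    (a v : V) : ~ derivable f a v -> 'D_v f a = 0.
Proof. by move/dvgP. Qed.

(* Without derivability both sides are 0, the default value of [lim] in [R]. *)
Lemma derive_oppV (R : realType) (V : normedModType R) (f : V -> R)
    (a v : V) : 'D_(- v) f a = - 'D_v f a.
Proof.
have [df|ndf] := pselect (derivable f a v).
  by apply/cvg_lim => //; exact: cvg_growth_rateN.
have ndfN : ~ derivable f a (- v).
  by move/derivable_oppV; rewrite opprK.
by rewrite (derive_default ndf) (derive_default ndfN) oppr0.
Qed.

(** The quotients agree before any limit is taken, so both derivability and the value of the
    derivative, default included, transfer to the reflected function. *)
Lemma growth_rate_reflect (R : realType) (V : normedModType R) (f : V -> R)
    (a v : V) :
  (fun h : R => h^-1 *: (((fun x => f (- x)) \o shift a) (h *: v) - f (- a))) =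
  (fun h => h^-1 *: ((f \o shift (- a)) (h *: - v) - f (- a))).
Proof. by apply/funext => h; rewrite /= opprD scalerN. Qed.

Lemma derivable_reflect (R : realType) (V : normedModType R) (f : V -> R)
    (a v : V) :
  derivable f (- a) v -> derivable (fun x => f (- x)) a v.
Proof. by move/derivable_oppV; rewrite /derivable growth_rate_reflect. Qed.

Lemma derive_reflect (R : realType) (V : normedModType R) (f : V -> R)
    (a v : V) : 'D_v (fun x => f (- x)) a = - 'D_v f (- a).
Proof. by rewrite -derive_oppV /derive growth_rate_reflect. Qed.

Lemma derivable_sign_mul (R : realType) (V : normedModType R) (f : V -> R)
    (a v : V) (b : bool) :
  derivable f a v -> derivable (fun x => (-1) ^+ b * f x) a v.
Proof.
case: b => df.
  by rewrite (_ : (fun _ => _) = - f);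
    [exact: derivableN|apply/funext => x; rewrite mulN1r].
by rewrite (_ : (fun _ => _) = f)//; apply/funext => x; rewrite mul1r.
Qed.

Lemma derive_oppf (R : realType) (V : normedModType R) (f : V -> R)
    (a v : V) : 'D_v (fun x => - f x) a = - 'D_v f a.
Proof.
have [df|ndf] := pselect (derivable f a v); first exact: deriveN.
have ndfN : ~ derivable (fun x => - f x) a v.
  move/derivableN; suff -> : - (fun x => - f x) = f by [].
  by apply/funext => x; exact: opprK.
by rewrite (derive_default ndf) (derive_default ndfN) oppr0.
Qed.

(** Each derivative contributes one sign. As [derive_oppf] and [derive_reflect] hold for arbitrary
    functions, this is an equality of functions without smoothness, and the induction can rewrite
    under the next derivative. *)
Lemma pderivs_reflect (R : realType) (d : nat) (s : seq 'I_d)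
    (f : 'rV[R]_d -> R) :
  pderivs s (fun x => f (- x)) =
  (fun x => (-1) ^+ odd (size s) * pderivs s f (- x)).
Proof.
elim: s => [|i s IH] /=; first by apply/funext => x; rewrite mul1r.
rewrite IH /pderiv; apply/funext => x.
case: (odd (size s)); rewrite ?expr0 ?expr1.
  under [fun y => _ * _]funext => y do rewrite mulN1r.
  by rewrite derive_oppf derive_reflect opprK mul1r.
under [fun y => _ * _]funext => y do rewrite mul1r.
by rewrite derive_reflect mulN1r.
Qed.

Lemma smooth_on_reflect (R : realType) (d : nat) (D : set 'rV[R]_d)
    (f : 'rV[R]_d -> R) :
  (forall x, D x -> D (- x)) ->
  smooth_on D f -> smooth_on D (fun x => f (- x)).
Proof.
move=> DN sf s x Dx; have [fc fd] := sf s _ (DN _ Dx).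
rewrite pderivs_reflect; split=> [|i]; last first.
  by apply: derivable_sign_mul; exact: derivable_reflect.
have fNc : {for x, continuous (fun y : 'rV[R]_d => pderivs s f (- y))}.
  exact: (continuous_comp (@oppr_continuous _ _ x) fc).
exact: (@continuousM R 'rV[R]_d (cst _) (fun y : 'rV[R]_d => _) x
  (@cst_continuous _ _ _ x) fNc).
Qed.

Lemma csmooth_on_reflect (R : realType) (d : nat) (D : set 'rV[R]_d)
    (f : 'rV[R]_d -> R[i]) :
  (forall x, D x -> D (- x)) ->
  csmooth_on D f -> csmooth_on D (fun x => f (- x)).
Proof.
move=> DN [fr fi]; split.
- exact: (smooth_on_reflect (f := fun x => complex.Re (f x))).
- exact: (smooth_on_reflect (f := fun x => complex.Im (f x))).
Qed.

(** Openness of [D] turns agreement on [D] into agreement near each of its points, at every stage of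
    the induction. *)
Lemma pderivs_local (R : realType) (d : nat) (D : set 'rV[R]_d)
    (s : seq 'I_d) (f g : 'rV[R]_d -> R) :
  open D -> (forall x, D x -> f x = g x) ->
  forall x, D x -> pderivs s f x = pderivs s g x.
Proof.
move=> oD fg; elim: s => [//|i s IH] x Dx /=.
apply: near_eq_derive; have : nbhs x D by exact: open_nbhs_nbhs.
exact: filterS.
Qed.

Lemma hessian_reflect (R : realType) (d : nat) (D : set 'rV[R]_d)
    (f g : 'rV[R]_d -> R[i]) (x : 'rV[R]_d) :
  open D -> (forall y, D y -> f y = g (- y)) -> D x ->
  hessian f x = hessian g (- x).
Proof.
move=> oD fg Dx.
have hess (p : R[i] -> R) (i j : 'I_d) :
    pderivs [:: i; j] (fun y => p (f y)) x =
    pderivs [:: i; j] (fun y => p (g y)) (- x).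
  transitivity (pderivs [:: i; j] (fun y => p (g (- y))) x).
    by apply: (pderivs_local _ oD) => // y /fg ->.
  (* Two derivatives give the sign [(-1) ^+ odd 2], which computes to 1. *)
  have := pderivs_reflect [:: i; j] (fun y => p (g y)).
  by move/(congr1 (@^~ x)) => ->; exact: mul1r.
apply: eq_mx => i j.
by rewrite (hess (@complex.Re _)) (hess (@complex.Im _)).
Qed.

(** * Smooth functions of one variable built from exp(-1/y) *)

Section FlatFunctions.
Context {R : realType}.
Implicit Types (n : nat) (y t : R) (p w : {poly R}).

(** For [n = 0] this is the classical smooth function that is flat at 0; the negative powers of [y]
    are those produced by differentiating it. *)
Definition flat n y : R := if 0 < y then y^-1 ^+ n * expR (- y^-1) else 0.

Lemma flat_ge0 n y : 0 <= flat n y.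
Proof.
rewrite /flat; case: ifP => // y0.
by rewrite mulr_ge0 ?expR_ge0// exprn_ge0// invr_ge0 ltW.
Qed.

Lemma flat_gt0 n y : 0 < y -> 0 < flat n y.
Proof.
by move=> y0; rewrite /flat y0 mulr_gt0 ?expR_gt0// exprn_gt0// invr_gt0.
Qed.

Lemma flat_le0 n y : y <= 0 -> flat n y = 0.
Proof. by move=> y0; rewrite /flat ltNge y0. Qed.

Lemma flatS n y : flat n y = y * flat n.+1 y.
Proof.
rewrite /flat; case: ifP => [y0|_]; last by rewrite mulr0.
by rewrite exprS !mulrA mulfV ?mul1r// gt_eqF.
Qed.

(** For positive [y], exp(1/y) is at least the term y^-(n+1) / (n+1)! of its series. The bound
    forces [flat n] to tend to 0 at the origin. *)
Lemma flat_le_linear n y : `|flat n y| <= n.+1`!%:R * `|y|.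
Proof.
have [y0|/flat_le0->] := ltP 0 y; last by rewrite normr0 mulr_ge0.
rewrite ger0_norm ?flat_ge0// gtr0_norm// /flat y0.
have yV0 : 0 <= y^-1 by rewrite invr_ge0 ltW.
have fac0 : 0 < n.+1`!%:R :> R by rewrite ltr0n fact_gt0.
have : y^-1 ^+ n.+1 / n.+1`!%:R <= expR y^-1.
  by apply: le_trans (expR_ge1Dxn n yV0); rewrite lerDr.
rewrite ler_pdivrMr// exprS ler_pdivrMl// => le_exp.
rewrite expRN ler_pdivrMr ?expR_gt0//.
by rewrite [leRHS](_ : _ = y * (expR y^-1 * n.+1`!%:R))//; ring.
Qed.

Lemma is_derive_flat n y :
  is_derive y (1 : R) (flat n) (flat n.+2 y - n%:R * flat n.+1 y).
Proof.
have [y0|y0|y0] := ltgtP y 0.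
- rewrite !flat_le0 ?(ltW y0)// mulr0 subr0.
  apply: (@near_eq_is_derive _ _ _ (cst 0)).
  near=> z; rewrite flat_le0//; near: z.
  exact: lt_le_nbhsl.
- apply: (@near_eq_is_derive R R R (fun z : R => z^-1 ^+ n * expR (- z^-1))).
    near=> z; rewrite /flat ifT//; near: z.
    exact: lt_nbhsr.
  have yN0 : y != 0 by rewrite gt_eqF.
  have dV : is_derive y (1 : R) (fun z => z^-1) (- y ^- 2 *: 1).
    exact: (is_deriveV yN0 (is_derive_id y (1 : R))).
  have dX := is_deriveX n dV.
  have dE := @is_derive1_comp R expR (fun z => - z^-1) y _ _
    (is_derive_expR (- y^-1)) (is_deriveN dV).
  have /is_derive_eq := is_deriveM dX dE; rewrite exprfctE; apply.
  rewrite /flat y0 /= /GRing.scale /=.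
  case: n {dX} => [|n]; rewrite ?exprS /=; field; exact: yN0.
- rewrite y0.
  have fl : h^-1 *: (flat n (h *: (1 : R) + 0) - flat n 0) @[h --> 0^'] --> (0:R).
    (* By [flatS] the difference quotient of [flat n] at 0 is exactly [flat n.+1]; at [h = 0] both
       sides are 0. *)
    have -> : (fun h : R => h^-1 *: (flat n (h *: (1 : R) + 0) - flat n 0)) =
        flat n.+1.
      apply/funext => h; rewrite [h *: _]mulr1 addr0 [flat n 0]flat_le0// subr0.
      rewrite flatS; have [->|h0] := eqVneq h 0.
        by rewrite flat_le0// mulr0 scaler0.
      by rewrite -[LHS]/(_ * _) mulKf.
    apply: cvg_within_filter; apply/cvgr0Pnorm_le => e e0.
    have fac0 : 0 < n.+2`!%:R :> R by rewrite ltr0n fact_gt0.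
    have efac0 : 0 < (n.+2`!%:R)^-1 * e by rewrite mulr_gt0// invr_gt0.
    apply: filterS (nbhs0_lt (V := R) efac0) => h h_lt.
    apply: le_trans (flat_le_linear _ _) _.
    by rewrite -ler_pdivlMl// ltW.
  apply: DeriveDef; first by apply/cvg_ex; exists 0.
  by rewrite !flat_le0// mulr0 subr0; exact/cvg_lim.
Unshelve. all: by end_near. Qed.

Definition flat_poly p w n t : R := p.[t] * flat n w.[t].

(* The functions [t |-> p(t) w(t)^-n exp(-1/w(t))], cut off where [w <= 0], are
   stable under differentiation, hence smooth. *)
Lemma is_derive_flat_poly p w n t :
  is_derive t (1 : R) (flat_poly p w n)
    (flat_poly (p^`() * w ^+ 2 + p * w^`() - p * w^`() * w *+ n) w n.+2 t).
Proof.
have dw := @is_derive1_comp R (flat n) (horner w) t _ _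
  (is_derive_flat n w.[t]) (is_derive_poly w t).
have /is_derive_eq := is_deriveM (is_derive_poly p t) dw; apply.
(* Raising all indices to [n.+2] costs powers of [w] and leaves a polynomial identity. *)
rewrite /flat_poly /= /GRing.scale /= (flatS n) (flatS n.+1).
rewrite !hornerE hornerMn !hornerE -[_ *+ n]mulr_natl /=.
ring.
Qed.

Lemma flat_poly_ge0 p w n t : 0 <= p.[t] -> 0 <= flat_poly p w n t.
Proof. by move=> p0; rewrite mulr_ge0// flat_ge0. Qed.

End FlatFunctions.

(** * A smooth bump supported in a cube, with quantitative bounds *)

Section Bump.
Variables (R : realType) (d : nat) (x0 : 'rV[R]_d) (r : R).
Hypothesis r0 : 0 < r.

Let w (j : 'I_d) : {poly R} := (r ^+ 2)%:P - ('X - (x0 0 j)%:P) ^+ 2.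

Let wE j t : (w j).[t] = r ^+ 2 - (t - x0 0 j) ^+ 2.
Proof. by rewrite /w !hornerE. Qed.

Let w_gt0 j t : (0 < (w j).[t]) = (`|t - x0 0 j| < r).
Proof.
by rewrite wE subr_gt0 -real_normK ?num_real// ltr_pXn2r ?nnegrE// ltW.
Qed.

(** One polynomial and one exponent per coordinate are left free so that the class is stable under
    every partial derivative. *)
Definition flat_prod (p : 'I_d -> {poly R}) (n : 'I_d -> nat)
  (x : 'rV[R]_d) : R := \prod_j flat_poly (p j) (w j) (n j) (x 0 j).

Definition bump : 'rV[R]_d -> R := flat_prod (fun=> 1) (fun=> 0%N).

(** Only the factor of index [i] varies along the [i]-th unit vector; the product [c] of the others
    is constant. *)
Lemma flat_prod_is_derive p n (i : 'I_d) x :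
  let p' := (p i)^`() * w i ^+ 2 + p i * (w i)^`()
    - p i * (w i)^`() * w i *+ n i in
  is_derive x (unit_vec R i) (flat_prod p n)
    (flat_prod (fun j => if j == i then p' else p j)
      (fun j => if j == i then (n j).+2 else n j) x).
Proof.
move=> p'.
pose g := flat_poly (p i) (w i) (n i).
pose c := \prod_(j | j != i) flat_poly (p j) (w j) (n j) (x 0 j).
have dg : is_derive (x 0 i) (1 : R) g (flat_poly p' (w i) (n i).+2 (x 0 i)).
  exact: is_derive_flat_poly.
have lim : h^-1 *: (flat_prod p n (h *: unit_vec R i + x) - flat_prod p n x)
    @[h --> 0^'] --> c * flat_poly p' (w i) (n i).+2 (x 0 i).
  have -> : (fun h : R => h^-1 *:
      (flat_prod p n (h *: unit_vec R i + x) - flat_prod p n x)) =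
      (fun h : R => c * (h^-1 *: (g (h *: (1 : R) + x 0 i) - g (x 0 i)))).
    apply/funext => h; rewrite /flat_prod (bigD1 i)//= [in X in _ - X](bigD1 i)//=.
    rewrite [X in _ * X - _](_ : _ = c); last first.
      apply: eq_bigr => j ji.
      by rewrite !mxE eqxx/= (negbTE ji) mulr0 add0r.
    rewrite !mxE !eqxx /= -/g -/c /GRing.scale /=; ring.
  apply: cvgMr.
  by case: dg => + <-; exact.
apply: DeriveDef; first by apply/cvg_ex; eexists; exact: lim.
transitivity (c * flat_poly p' (w i) (n i).+2 (x 0 i)); first exact/cvg_lim.
rewrite /flat_prod (bigD1 i)//= !eqxx mulrC; congr (_ * _).
by apply: eq_bigr => j /negbTE ->.
Qed.

Lemma flat_poly_continuous (p q : {poly R}) n : continuous (flat_poly p q n).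
Proof.
move=> t; have [+ _] := is_derive_flat_poly p q n t.
by move/derivable1_diffP/differentiable_continuous.
Qed.

Lemma flat_prod_continuous p n : continuous (flat_prod p n).
Proof.
rewrite /flat_prod; apply: continuous_big => [|j _ x].
  exact: mul_continuous.
by apply: continuous_comp; [exact: coord_continuous|exact: flat_poly_continuous].
Qed.

Lemma bump_smooth : smooth_on setT bump.
Proof.
have pderivsE s : exists p n, pderivs s bump = flat_prod p n.
  elim: s => [|i s [p [n /= ->]]]; first by exists (fun=> 1), (fun=> 0%N).
  do 2 eexists; apply/funext => x.
  by have [_ +] := flat_prod_is_derive p n i x; exact.
move=> s x _; have [p [n ->]] := pderivsE s; split.
  exact: flat_prod_continuous.
by move=> i; have [] := flat_prod_is_derive p n i x.
Qed.

Lemma bump_ge0 x : 0 <= bump x.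
Proof. by apply: prodr_ge0 => j _; rewrite flat_poly_ge0// hornerC. Qed.

Lemma bump_neq0 x : bump x != 0 -> forall j, `|x 0 j - x0 0 j| < r.
Proof.
move=> /prodf_neq0 bx j; rewrite -w_gt0 ltNge; apply/negP => /flat_le0 wx.
by have /eqP[] := bx j isT; rewrite /flat_poly wx mulr0.
Qed.

Lemma bump_le1 x : bump x <= 1.
Proof.
rewrite /bump /flat_prod; apply: prodr_ile1 => j _.
rewrite flat_poly_ge0 ?hornerC//= /flat_poly hornerC mul1r /flat.
case: ifP => // wx; rewrite expr0 mul1r -expR0 ler_expR oppr_le0 invr_ge0.
exact: ltW.
Qed.

(** The bump's product with every argument [w j] lowered to r^2/2. On the cube of half size [w j] is
    at least 3r^2/4, so this is a lower bound there. *)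
Definition bump_min : R := \prod_(j < d) flat 0 (r ^+ 2 / 2).

Lemma bump_min_gt0 : 0 < bump_min.
Proof.
by apply: prodr_gt0 => j _; rewrite flat_gt0// divr_gt0// exprn_gt0.
Qed.

Lemma bump_ge_min (x : 'rV[R]_d) :
  (forall j, `|x 0 j - x0 0 j| <= r / 2) -> bump_min <= bump x.
Proof.
move=> xr; rewrite /bump /flat_prod; apply: ler_prod => j _.
rewrite flat_ge0 /flat_poly hornerC mul1r /=.
have r20 : 0 < r ^+ 2 / 2 by rewrite divr_gt0// exprn_gt0.
have wr : r ^+ 2 / 2 <= (w j).[x 0 j].
  rewrite wE -(real_normK (num_real (_ - _))).
  have : `|x 0 j - x0 0 j| ^+ 2 <= (r / 2) ^+ 2.
    by rewrite ler_pXn2r ?nnegrE// divr_ge0// ltW.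
  by rewrite expr_div_n => ?; have := sqr_ge0 r; nra.
rewrite /flat r20 (lt_le_trans r20 wr) !expr0 !mul1r ler_expR lerN2.
by rewrite lef_pV2 ?posrE// (lt_le_trans r20 wr).
Qed.

Lemma measurable_bump_comp d' (T : measurableType d') (e : T -> 'rV[R]_d) :
  (forall j, measurable_fun setT (fun p => e p 0 j)) ->
  measurable_fun setT (fun p => bump (e p)).
Proof.
move=> me; rewrite /bump /flat_prod; apply: measurable_prod => j _.
apply: (measurableT_comp _ (me j)).
by apply: continuous_measurable_fun; exact: flat_poly_continuous.
Qed.

End Bump.

(** * Monotonicity and invariance of the integral for arbitrary functions *)

Section IntegralOfArbitraryFunctions.
Context d (T : measurableType d) (R : realType).
Variable mu : {measure set T -> \bar R}.
Local Open Scope ereal_scope.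

(* The library integral of a non-negative function is a supremum over simple
   functions below it, hence monotone without any measurability hypothesis. *)
Lemma ge0_le_integral_any (f g : T -> \bar R) :
  (forall x, 0 <= f x) -> (forall x, f x <= g x) ->
  \int[mu]_x f x <= \int[mu]_x g x.
Proof.
move=> f0 fg; rewrite !ge0_integralTE//; last first.
  by move=> x; exact: le_trans (fg x).
apply: le_ereal_sup => _ [h /= hf <-]; exists h => // x.
exact: le_trans (fg x).
Qed.

Lemma le_integral_any (f g : T -> \bar R) :
  (forall x, f x <= g x) -> \int[mu]_x f x <= \int[mu]_x g x.
Proof.
move=> fg; rewrite integralE [leRHS]integralE; apply: leeB.
  apply: ge0_le_integral_any => x; first exact: funepos_ge0.
  exact: (@funepos_le _ _ setT f g (fun y _ => fg y) x (in_setT _)).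
apply: ge0_le_integral_any => x; first exact: funeneg_ge0.
exact: (@funeneg_le _ _ setT f g (fun y _ => fg y) x (in_setT _)).
Qed.

Import HBNNSimple.

Variable phi : T -> T.
Hypothesis mphi : measurable_fun setT phi.
Hypothesis phiK : involutive phi.
Hypothesis phi_mu : forall A, measurable A -> mu (phi @^-1` A) = mu A.

(** Change of variables for the pushforward of [mu] by [phi], which coincides with [mu] on
    measurable sets. *)
Lemma measurable_ge0_integral_involution (h : T -> R) :
  measurable_fun setT h -> (forall x, 0 <= h x)%R ->
  \int[mu]_x (h x)%:E = \int[mu]_x (h (phi x))%:E.
Proof.
move=> mh h0; have mEh : measurable_fun setT (EFin \o h).
  exact/measurable_EFinP.
have Eh0 : {in setT, forall y, 0 <= (EFin \o h) y}.
  by move=> y _; rewrite lee_fin.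
transitivity (\int[pushforward mu phi]_x (h x)%:E).
  by apply: eq_measure_integral => A mA _; exact/esym/phi_mu.
by rewrite (ge0_integral_pushforward mphi mu measurableT mEh Eh0) preimage_setT.
Qed.

(** A simple function below [g], composed with [phi], is a measurable function below [g \o phi] with
    the same integral. This yields one inequality for non-negative [g]; since [phi] is involutive,
    the same inequality for [g \o phi] is the converse. *)
Lemma integral_involution_any (f : T -> \bar R) :
  \int[mu]_x f (phi x) = \int[mu]_x f x.
Proof.
have le (g : T -> \bar R) : (forall x, 0 <= g x) ->
    \int[mu]_x g x <= \int[mu]_x g (phi x).
  move=> g0; rewrite ge0_integralTE//.
  apply: ge_ereal_sup => _ [h /= hg <-].
  have -> : sintegral mu h = \int[mu]_x (h x)%:E.
    by rewrite integral_nnsfun// patch_setT.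
  rewrite (measurable_ge0_integral_involution (h := h)) => [||x]; last first.
  - exact: fun_ge0.
  - exact: measurable_funPT.
  by apply: ge0_le_integral_any => x; [rewrite lee_fin|exact: hg].
have eq0 (g : T -> \bar R) : (forall x, 0 <= g x) ->
    \int[mu]_x g (phi x) = \int[mu]_x g x.
  move=> g0; apply/eqP; rewrite eq_le le// andbT.
  rewrite (le_trans (le (fun x => g (phi x)) _))//.
  by rewrite (eq_integral g)// => x _; rewrite phiK.
rewrite integralE [RHS]integralE.
congr (_ - _).
  rewrite -(eq0 (fun x => f^\+ x)) => [|x]; last exact: funepos_ge0.
  by apply: eq_integral => x _; rewrite !funeposE.
rewrite -(eq0 (fun x => f^\- x)) => [|x]; last exact: funeneg_ge0.
by apply: eq_integral => x _; rewrite !funenegE.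
Qed.

End IntegralOfArbitraryFunctions.

(** * Reflection invariance of Lebesgue integrals in the plane and in space *)

Definition measure_involution d (T : measurableType d) (R : realType)
    (mu : set T -> \bar R) (phi : T -> T) : Prop :=
  [/\ measurable_fun setT phi, involutive phi &
      forall A, measurable A -> mu (phi @^-1` A) = mu A].

Lemma lebesgue_measure_involution (R : realType) :
  measure_involution (@lebesgue_measure R)
    (-%R : measurableTypeR R -> measurableTypeR R).
Proof.
split; [exact: oppr_measurable|exact: opprK|exact: lebesgue_measureN].
Qed.

(** The section at [x] of the preimage of [A] is the preimage under [phi2] of the section of [A] at
    [phi1 x]. Invariance of [m2] handles the sections, and invariance of the integral under [phi1]
    handles the outer variable. *)
Lemma product_measure_involution d1 d2 (T1 : measurableType d1)
    (T2 : measurableType d2) (R : realType) (m1 : {measure set T1 -> \bar R})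
    (m2 : {sigma_finite_measure set T2 -> \bar R})
    (phi1 : T1 -> T1) (phi2 : T2 -> T2) :
  measure_involution m1 phi1 -> measure_involution m2 phi2 ->
  measure_involution (m1 \x m2)%E (fun p => (phi1 p.1, phi2 p.2)).
Proof.
move=> [mphi1 phi1K m1E] [mphi2 phi2K m2E]; split.
- apply/measurable_fun_pairP; split.
    exact: (measurableT_comp mphi1 measurable_fst).
  exact: (measurableT_comp mphi2 measurable_snd).
- by move=> [x y] /=; rewrite phi1K phi2K.
- move=> A mA; rewrite /product_measure1.
  rewrite -[RHS](integral_involution_any mphi1 phi1K m1E).
  apply: eq_integral => x _ /=.
  rewrite -(m2E (xsection A (phi1 x))); last exact: measurable_xsection.
  by congr (m2 _); apply/seteqP; split=> y; rewrite /xsection /= !in_setE.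
Qed.

Lemma integral2_reflect (R : realType) (f : 'rV[R]_2 -> R) :
  integral2 (fun x => f (- x)) = integral2 f.
Proof.
have [mphi phiK phiE] := product_measure_involution
  (lebesgue_measure_involution R) (lebesgue_measure_involution R).
rewrite /integral2 /Rintegral -[in RHS](integral_involution_any mphi phiK phiE).
congr fine; apply: eq_integral => p _; congr (f _)%:E.
by apply/rowP => -[[|[|]]]// i; rewrite !mxE.
Qed.

Lemma integral3_reflect (R : realType) (f : 'rV[R]_3 -> R) :
  integral3 (fun x => f (- x)) = integral3 f.
Proof.
have [mphi phiK phiE] := product_measure_involution
  (product_measure_involution (lebesgue_measure_involution R)
    (lebesgue_measure_involution R)) (lebesgue_measure_involution R).
rewrite /integral3 /Rintegral -[in RHS](integral_involution_any mphi phiK phiE).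
congr fine; apply: eq_integral => p _; congr (f _)%:E.
by apply/rowP => -[[|[|[|]]]]// i; rewrite !mxE.
Qed.

(** * Cubes, and separation of continuous functions by integrals against bumps *)

Definition closed_box (R : realType) (d : nat) (x : 'rV[R]_d) (s : R) :
  set 'rV[R]_d := [set y | forall j, `|y 0 j - x 0 j| <= s].

Lemma nbhs_closed_box (R : realType) (d : nat) (x : 'rV[R]_d)
    (A : set 'rV[R]_d) :
  nbhs x A -> exists2 s, 0 < s & closed_box x s `<=` A.
Proof.
move=> /nbhs_ballP[e /= e0 eA]; exists (e / 2); first by rewrite divr_gt0.
move=> y yx; apply: eA; split=> // i j; rewrite ord1 /ball/= distrC.
apply: le_lt_trans (yx j) _; rewrite ltr_pdivrMr//.
by rewrite ltr_pMr// ltr1n.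
Qed.

Lemma compact_closed_box (R : realType) (d : nat) (x : 'rV[R]_d) (s : R) :
  compact (closed_box x s).
Proof.
have := @rV_compact R d (fun j => `[x 0 j - s, x 0 j + s]%classic)
  (fun j => @segment_compact _ _ _).
congr compact; apply/seteqP; split=> y /= ys j.
  by have := ys j; rewrite in_itv/= ler_distl.
by rewrite in_itv/= -ler_distl.
Qed.

Lemma bump_support_closure (R : realType) (d : nat) (x : 'rV[R]_d) (r : R) :
  0 < r -> closure [set y | bump x r y != 0] `<=` closed_box x r.
Proof.
move=> r0; have /closure_id -> : closed (closed_box x r).
  apply: compact_closed; last exact: compact_closed_box.
  exact: norm_hausdorff.
apply: closure_subset => y /= by0 j; apply: ltW.
by apply: bump_neq0 by0 _.
Qed.

(* [e] identifies the measure space [T] with ['rV_d], as in [integral2] and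
   [integral3]; only the measures of boxes matter. *)
Definition box_measure (R : realType) (d : nat) disp
    (T : measurableType disp) (mu : {measure set T -> \bar R})
    (e : T -> 'rV[R]_d) : Prop :=
  (forall j, measurable_fun setT (fun p => e p 0 j)) /\
  forall x s, 0 < s -> measurable (e @^-1` closed_box x s) /\
    (0 < mu (e @^-1` closed_box x s) < +oo)%E.

Section Separation.
Context (R : realType) (d : nat) disp (T : measurableType disp)
  (mu : {measure set T -> \bar R}) (e : T -> 'rV[R]_d).
Hypothesis mu_box : box_measure mu e.
Variables (x : 'rV[R]_d) (r : R).
Hypothesis r0 : 0 < r.

Lemma measurable_bump_EFin :
  measurable_fun setT (fun p => (bump x r (e p))%:E).
Proof.
by apply/measurable_EFinP; apply: measurable_bump_comp; case: mu_box.
Qed.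

(** The integral lies between [bump_min] times the measure of the half-size cube and the measure of
    the full cube. *)
Lemma integral_bump :
  exists2 b : R, 0 < b & (\int[mu]_p (bump x r (e p))%:E)%E = b%:E.
Proof.
have [mbox box_gt0] := mu_box.2 x _ (divr_gt0 r0 (ltr0Sn R 1)).
have [mBox Box_gt0] := mu_box.2 x _ r0.
have lb : (0 < \int[mu]_p (bump x r (e p))%:E)%E.
  apply: (@lt_le_trans _ _ (\int[mu]_p
      ((bump_min d r)%:E * (\1_(e @^-1` closed_box x (r / 2)) p)%:E))%E).
    rewrite ge0_integralZl//; last 2 first.
    - by apply/measurable_EFinP.
    - by rewrite lee_fin ltW// bump_min_gt0.
    rewrite integral_indic// setIT mule_gt0 ?lte_fin ?bump_min_gt0//.
    by case/andP: box_gt0.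
  apply: ge0_le_integral_any => p.
    by rewrite mule_ge0// lee_fin ltW// bump_min_gt0.
  rewrite -EFinM lee_fin indicE; case: (boolP (_ \in _)) => [|_].
    by rewrite inE /= => pbox; rewrite mulr1 bump_ge_min.
  by rewrite mulr0 bump_ge0.
have ub : (\int[mu]_p (bump x r (e p))%:E < +oo)%E.
  apply: (@le_lt_trans _ _ (\int[mu]_p
      (\1_(e @^-1` closed_box x r) p)%:E)%E).
    apply: ge0_le_integral_any => p; first by rewrite lee_fin bump_ge0.
    rewrite lee_fin indicE; case: (boolP (_ \in _)) => [_|].
      exact: bump_le1.
    rewrite notin_setE /=; apply: contra_notT; rewrite -ltNge.
    move=> /lt0r_neq0 /(bump_neq0 r0) pb j; exact/ltW/pb.
  by rewrite integral_indic// setIT; case/andP: Box_gt0.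
exists (fine (\int[mu]_p (bump x r (e p))%:E)%E).
  by rewrite fine_gt0// lb.
by rewrite fineK// ge0_fin_numE// ltW.
Qed.

(** [H] may fail to be measurable along [e]: only monotonicity is applied to it, and linearity is
    used for the bump alone. The two bounds also make the integral finite, so [fine] preserves
    them. *)
Lemma integral_between_bump (H : 'rV[R]_d -> R) (m M b : R) :
  (forall y, m * bump x r y <= H y <= M * bump x r y) ->
  (\int[mu]_p (bump x r (e p))%:E)%E = b%:E ->
  m * b <= \int[mu]_p H (e p) <= M * b.
Proof.
move=> mHM intb.
have ib : mu.-integrable setT (fun p => (bump x r (e p))%:E).
  apply/integrableP; split; first exact: measurable_bump_EFin.
  rewrite (eq_integral (fun p => (bump x r (e p))%:E)) ?intb ?ltry// => p _.
  by rewrite gee0_abs// lee_fin bump_ge0.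
have intZ c : (\int[mu]_p (c * bump x r (e p))%:E = (c * b)%:E)%E.
  by rewrite EFinM -intb -integralZl.
have lb : ((m * b)%:E <= \int[mu]_p (H (e p))%:E)%E.
  rewrite -intZ; apply: le_integral_any => p; rewrite lee_fin.
  by case/andP: (mHM (e p)).
have ub : (\int[mu]_p (H (e p))%:E <= (M * b)%:E)%E.
  rewrite -intZ; apply: le_integral_any => p; rewrite lee_fin.
  by case/andP: (mHM (e p)).
have fin : (\int[mu]_p (H (e p))%:E)%E \is a fin_num.
  by rewrite fin_numE -ltNye -ltey (lt_le_trans _ lb) ?ltNyr// (le_lt_trans ub) ?ltry.
by rewrite -!lee_fin /Rintegral fineK// lb ub.
Qed.

End Separation.

Lemma continuous_separated_by_bump (R : realType) (d : nat) disp
    (T : measurableType disp) (mu : {measure set T -> \bar R})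
    (e : T -> 'rV[R]_d) (D : set 'rV[R]_d) (F G : 'rV[R]_d -> R) x :
  box_measure mu e -> nbhs x D ->
  {for x, continuous F} -> {for x, continuous G} -> F x < G x ->
  exists2 r, 0 < r & closed_box x r `<=` D /\
    \int[mu]_p (F (e p) * bump x r (e p)) <
    \int[mu]_p (G (e p) * bump x r (e p)).
Proof.
(* Two levels [c < c'] strictly between [F x] and [G x] keep the inequality of the integrals
   strict. *)
move=> mu_box Dx Fc Gc FG; pose c := (F x + G x) / 2.
have Fxc : F x < c by rewrite /c; lra.
have cGx : c < G x by rewrite /c; lra.
pose c' := (c + G x) / 2.
have cc' : c < c' by rewrite /c'; lra.
have c'Gx : c' < G x by rewrite /c'; lra.
(* The outer bounds [F x - 1] and [G x + 1] serve finiteness: the sandwich lemma needs a bound on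
   both sides. *)
have near_x : nbhs x [set y | [/\ D y, F x - 1 <= F y <= c &
    c' <= G y <= G x + 1]].
  near=> y; split.
  - by near: y.
  - apply/andP; split; near: y; [apply: (cvgr_ge (F x))|apply: (cvgr_le (F x))];
      by [exact: Fc|lra].
  - apply/andP; split; near: y; [apply: (cvgr_ge (G x))|apply: (cvgr_le (G x))];
      by [exact: Gc|lra].
have [r r0 rbox] := nbhs_closed_box near_x; exists r => //; split.
  by move=> y /rbox[].
have [b b0 intb] := integral_bump mu_box x r0.
have between (H : 'rV[R]_d -> R) m M :
    (forall y, closed_box x r y -> m <= H y <= M) ->
    forall y, m * bump x r y <= H y * bump x r y <= M * bump x r y.
  move=> mHM y; have [->|/(bump_neq0 r0) by0] := eqVneq (bump x r y) 0.
    by rewrite !mulr0 lexx.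
  have /mHM/andP[mH HM] : closed_box x r y by move=> j; exact/ltW/by0.
  by rewrite !ler_wpM2r ?bump_ge0.
have /andP[_ FM] := integral_between_bump mu_box
  (between F _ _ (fun y yb => let: And3 _ h _ := rbox y yb in h)) intb.
have /andP[mG _] := integral_between_bump mu_box
  (between G _ _ (fun y yb => let: And3 _ _ h := rbox y yb in h)) intb.
apply: le_lt_trans FM _; apply: lt_le_trans mG.
by rewrite ltr_pM2r.
Unshelve. all: by end_near. Qed.

Lemma lebesgue_measure_segment (R : realType) (a s : R) : 0 < s ->
  lebesgue_measure `[a - s, a + s]%classic = (s *+ 2)%:E.
Proof.
move=> s0; rewrite lebesgue_measure_itv/= lte_fin ifT; last by lra.
by rewrite -EFinD; congr EFin; rewrite mulr2n; ring.
Qed.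

Lemma box_measure2 (R : realType) :
  box_measure (@lebesgue_measure R \x @lebesgue_measure R)%E
    (fun p : R * R => \row_(i < 2) [:: p.1; p.2]`_i).
Proof.
split=> [j|x s s0].
  under eq_fun do rewrite mxE.
  by case: j => -[|[|//]] /= _; [exact: measurable_fst|exact: measurable_snd].
have -> : (fun p : R * R => \row_(i < 2) [:: p.1; p.2]`_i)
    @^-1` closed_box x s =
    `[x 0 0 - s, x 0 0 + s]%classic `*` `[x 0 1 - s, x 0 1 + s]%classic.
  apply/seteqP; split=> -[p q] /=; rewrite /closed_box /= !in_itv/=.
    by move=> h; have := h 0; have := h 1; rewrite !mxE/= !ler_distl.
  move=> [h0 h1] j; rewrite mxE ler_distl.
  case: j => -[|[|//]] j2 /=.
    by rewrite (_ : Ordinal j2 = 0)//; exact: val_inj.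
  by rewrite (_ : Ordinal j2 = 1)//; exact: val_inj.
split; first exact: measurableX.
rewrite [X in (0 < X < _)%E](_ : _ = ((s *+ 2)%:E * (s *+ 2)%:E)%E); last first.
  by rewrite [LHS]product_measure1E//; congr (_ * _)%E;
    exact: lebesgue_measure_segment.
rewrite -EFinM ltry andbT lte_fin.
by rewrite mulr_gt0// pmulrn_lgt0.
Qed.

Lemma box_measure3 (R : realType) :
  box_measure ((@lebesgue_measure R \x @lebesgue_measure R)
      \x @lebesgue_measure R)%E
    (fun p : (R * R) * R => \row_(i < 3) [:: p.1.1; p.1.2; p.2]`_i).
Proof.
split=> [j|x s s0].
  under eq_fun do rewrite mxE.
  case: j => -[|[|[|//]]] /= _.
  - exact: (measurableT_comp measurable_fst measurable_fst).
  - exact: (measurableT_comp measurable_snd measurable_fst).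
  - exact: measurable_snd.
have -> : (fun p : (R * R) * R => \row_(i < 3) [:: p.1.1; p.1.2; p.2]`_i)
    @^-1` closed_box x s =
    (`[x 0 0 - s, x 0 0 + s]%classic `*` `[x 0 1 - s, x 0 1 + s]%classic) `*`
    `[x 0 ord_max - s, x 0 ord_max + s]%classic.
  apply/seteqP; split=> -[[p q] t] /=; rewrite /closed_box /= !in_itv/=.
    move=> h; have := h 0; have := h 1; have := h ord_max.
    by rewrite !mxE/= !ler_distl.
  move=> [[h0 h1] h2] j; rewrite mxE ler_distl.
  case: j => -[|[|[|//]]] j3 /=.
  - by rewrite (_ : Ordinal j3 = 0)//; exact: val_inj.
  - by rewrite (_ : Ordinal j3 = 1)//; exact: val_inj.
  - by rewrite (_ : Ordinal j3 = ord_max)//; exact: val_inj.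
have mA : measurable (`[x 0 0 - s, x 0 0 + s]%classic `*` `[x 0 1 - s, x 0 1 + s]%classic).
  exact: measurableX.
split; first exact: measurableX.
rewrite [X in (0 < X < _)%E](_ : _ =
    ((s *+ 2)%:E * (s *+ 2)%:E * (s *+ 2)%:E)%E); last first.
  rewrite [LHS]product_measure1E//; congr (_ * _)%E.
    by rewrite [LHS]product_measure1E//; congr (_ * _)%E;
      exact: lebesgue_measure_segment.
  exact: lebesgue_measure_segment.
by rewrite -!EFinM ltry andbT lte_fin !mulr_gt0// pmulrn_lgt0.
Qed.

(** * Test functions and unconditional sums: bumps, reflection, reindexing *)

Lemma smooth_on0 (R : realType) (d : nat) (D : set 'rV[R]_d) :
  smooth_on D (fun=> 0).
Proof.
move=> s x _; have -> : pderivs s (fun=> 0 : R) = (fun _ : 'rV[R]_d => 0 : R).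
  elim: s => [//|i s /= ->]; apply/funext => y; exact: derive_cst.
by split=> [|i]; [exact: cst_continuous|exact: derivable_cst].
Qed.

Lemma test_function_bump (R : realType) (d : nat) (D : set 'rV[R]_d) x r :
  0 < r -> closed_box x r `<=` D ->
  test_function D (fun y => (bump x r y)%:C%C).
Proof.
move=> r0 boxD.
have supp : support_closure (fun y => (bump x r y)%:C%C) `<=` closed_box x r.
  apply: subset_trans (bump_support_closure r0).
  apply: closure_subset => y /=; apply: contra_neq => ->; exact: rmorph0.
split.
- by split; [exact: bump_smooth|exact: smooth_on0].
- apply: (subclosed_compact _ (@compact_closed_box _ _ x r)) => //.
  exact: closed_closure.
- exact: subset_trans supp boxD.
Qed.

(** The reflected support is compact, being a continuous image of a compact set, hence closed; so it
    contains the support of the reflected function. *)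
Lemma test_function_reflect (R : realType) (d : nat) (D : set 'rV[R]_d) f :
  (forall x, D x -> D (- x)) ->
  test_function D f -> test_function D (fun x => f (- x)).
Proof.
move=> DN [fs fc fD].
have cN : compact (-%R @` support_closure f).
  apply: continuous_compact => //.
  apply: continuous_subspaceT => x; exact: oppr_continuous.
have supp : support_closure (fun x => f (- x)) `<=` -%R @` support_closure f.
  have /closure_id -> : closed (-%R @` support_closure f).
    by apply: compact_closed => //; exact: norm_hausdorff.
  apply: closure_subset => y /= fy; exists (- y); last by rewrite opprK.
  exact: subset_closure.
split.
- exact: csmooth_on_reflect.
- by apply: (subclosed_compact _ cN) => //; exact: closed_closure.
- by move=> y /supp[z /fD Dz <-]; exact: DN.
Qed.

Lemma csums_to_unique (R : realType) (I : choiceType) (a : I -> R[i]) s t :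
  csums_to a s -> csums_to a t -> s = t.
Proof.
have hausdorff := @norm_hausdorff _ (R[i] : numFieldType)^o.
move=> sa ta; apply: (cvg_unique hausdorff sa ta).
exact: (fmap_proper_filter _ totally_filter).
Qed.

(** Taking images under [sigma] permutes the finite index sets and preserves inclusion, so the limit
    along them is unchanged. *)
Lemma csums_to_reindex (R : realType) (I : choiceType) (sigma : I -> I)
    (a : I -> R[i]) s :
  involutive sigma -> csums_to a s -> csums_to (fun l => a (sigma l)) s.
Proof.
move=> sigmaK; have sigma_inj := inv_inj sigmaK.
rewrite /csums_to => cv.
have -> : partial_sum ((fun l => a (sigma l)) : I -> R[i]^o) =
    partial_sum (a : I -> R[i]^o) \o (fun A : {fset I} => (sigma @` A)%fset).
  apply/funext => A; rewrite /partial_sum /=.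
  rewrite -(big_seq_fsetE _ _ xpredT (fun l => a (sigma l))) /=.
  rewrite -(big_seq_fsetE _ _ xpredT a) /= big_imfset//=.
  by move=> x y _ _; exact: sigma_inj.
(* A finite set that contains the image of [A] under [sigma] has an image that contains [A], as
   [sigma] is its own inverse. *)
apply: cvg_comp cv => B [A _ AB]; exists (sigma @` A)%fset => // C /= AC.
apply: AB => /=; apply/fsubsetP => l lA; apply/imfsetP.
exists (sigma l); last by rewrite sigmaK.
by apply: (fsubsetP AC); exact: in_imfset.
Qed.

(** * Reflection and uniqueness of distributional sums, and the Lamé tensor *)

Section Reflection.
Context (R : realType) (d : nat) (integ : ('rV[R]_d -> R) -> R)
  (I : choiceType) (D : set 'rV[R]_d).
Hypothesis DN : forall x, D x -> D (- x).

(** Pairing the term [v l] with [f] amounts to pairing [u (sigma l)] with the reflection of [f],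
    again a test function; reindexing by [sigma] does the rest. *)
Lemma distribution_sum_reflect (u v : I -> 'rV[R]_d -> R[i])
    (sigma : I -> I) Phi :
  (forall f, integ (fun x => f (- x)) = integ f) ->
  involutive sigma -> (forall l x, v (sigma l) x = u l (- x)) ->
  distribution_sum integ u D Phi ->
  distribution_sum integ v D (fun x => Phi (- x)).
Proof.
move=> integN sigmaK vE [conv Phis Phisum].
have cintegN (f g : 'rV[R]_d -> R[i]) :
    cintegral integ (fun x => g (- x) * f x) =
    cintegral integ (fun x => g x * f (- x)).
  rewrite /cintegral -(integN (fun x => complex.Re (g x * f (- x)))).
  rewrite -(integN (fun x => complex.Im (g x * f (- x)))).
  by congr (integ _ +i* integ _)%C; apply/funext => x; rewrite opprK.
have pairE f : (fun l => cintegral integ (fun x => v l x * f x)) =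
    (fun l => cintegral integ (fun x => u (sigma l) x * f (- x))).
  apply/funext => l; rewrite -cintegN; congr cintegral; apply/funext => x.
  by rewrite -{1}(sigmaK l) vE.
split.
- move=> f tf; have [s us] := conv _ (test_function_reflect (D := setT)
    (fun _ Dx => Dx) tf).
  exists s; rewrite pairE; exact: (csums_to_reindex sigmaK us).
- exact: csmooth_on_reflect.
- move=> f tf; have us := Phisum _ (test_function_reflect DN tf).
  rewrite pairE cintegN; exact: (csums_to_reindex sigmaK us).
Qed.

Hypothesis oD : open D.
Context disp (T : measurableType disp) (mu : {measure set T -> \bar R})
  (e : T -> 'rV[R]_d).
Hypothesis mu_box : box_measure mu e.
Hypothesis integE : forall f, integ f = \int[mu]_p f (e p).

(** Unconditional sums are unique, so both candidates have the same pairing with every small bump at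
    [x]. The bump is real, so real and imaginary parts decouple, and a difference in either would be
    detected by [continuous_separated_by_bump]. *)
Lemma distribution_sum_unique (u : I -> 'rV[R]_d -> R[i]) Phi Psi x :
  distribution_sum integ u D Phi -> distribution_sum integ u D Psi ->
  D x -> Phi x = Psi x.
Proof.
move=> [_ Phis Phisum] [_ Psis Psisum] Dx.
have pair_eq r : 0 < r -> closed_box x r `<=` D ->
    integ (fun y => complex.Re (Phi y) * bump x r y) =
      integ (fun y => complex.Re (Psi y) * bump x r y) /\
    integ (fun y => complex.Im (Phi y) * bump x r y) =
      integ (fun y => complex.Im (Psi y) * bump x r y).
  move=> r0 boxD; have tb := test_function_bump r0 boxD.
  have := csums_to_unique (Phisum _ tb) (Psisum _ tb).
  have bRe (F : 'rV[R]_d -> R[i]) :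
      (fun y => complex.Re (F y * (bump x r y)%:C%C)) =
      (fun y => complex.Re (F y) * bump x r y).
    by apply/funext => y; case: (F y) => a b /=; rewrite mulr0 subr0.
  have bIm (F : 'rV[R]_d -> R[i]) :
      (fun y => complex.Im (F y * (bump x r y)%:C%C)) =
      (fun y => complex.Im (F y) * bump x r y).
    by apply/funext => y; case: (F y) => a b /=; rewrite mulr0 add0r.
  by rewrite /cintegral !bRe !bIm => -[].
have eq_of_pair (F G : 'rV[R]_d -> R) : smooth_on D F -> smooth_on D G ->
    (forall r, 0 < r -> closed_box x r `<=` D ->
      integ (fun y => F y * bump x r y) = integ (fun y => G y * bump x r y)) ->
    F x = G x.
  move=> sF sG FG.
  have Fc : {for x, continuous F} by have [] := sF [::] x Dx.
  have Gc : {for x, continuous G} by have [] := sG [::] x Dx.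
  have nD : nbhs x D by exact: open_nbhs_nbhs.
  apply/eqP; case: ltgtP => // ltFG.
    have [r r0 [boxD]] := continuous_separated_by_bump mu_box nD Fc Gc ltFG.
    by have := FG r r0 boxD; rewrite !integE /= => ->; rewrite ltxx.
  have [r r0 [boxD]] := continuous_separated_by_bump mu_box nD Gc Fc ltFG.
  by have := FG r r0 boxD; rewrite !integE /= => ->; rewrite ltxx.
have ReE : complex.Re (Phi x) = complex.Re (Psi x).
  apply: (eq_of_pair (fun y => complex.Re (Phi y)) (fun y => complex.Re (Psi y))).
  - by case: Phis.
  - by case: Psis.
  - by move=> r r0 boxD; have [] := pair_eq r r0 boxD.
have ImE : complex.Im (Phi x) = complex.Im (Psi x).
  apply: (eq_of_pair (fun y => complex.Im (Phi y)) (fun y => complex.Im (Psi y))).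
  - by case: Phis.
  - by case: Psis.
  - by move=> r r0 boxD; have [] := pair_eq r r0 boxD.
by move: ReE ImE; case: (Phi x) (Psi x) => [a b] [a' b'] /= -> ->.
Qed.

(** The representatives picked by [xget] for [u] and [v] are chosen independently. Reflecting the
    one for [v] gives another sum of [u], and uniqueness identifies them on [D]. *)
Lemma series_function_reflect (u v : I -> 'rV[R]_d -> R[i])
    (sigma : I -> I) x :
  (forall f, integ (fun x => f (- x)) = integ f) ->
  involutive sigma -> (forall l x, v (sigma l) x = u l (- x)) -> D x ->
  series_function integ u D x = series_function integ v D (- x).
Proof.
move=> integN sigmaK vE Dx.
have uE l y : u (sigma l) y = v l (- y).
  by rewrite -{2}(sigmaK l) vE opprK.
have refl_v := distribution_sum_reflect integN sigmaK vE.
have refl_u := distribution_sum_reflect integN sigmaK uE.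
have [[Phi uPhi]|no_u] := pselect (exists Phi, distribution_sum integ u D Phi).
  have su : distribution_sum integ u D (series_function integ u D).
    by apply: (xgetPex (fun=> 0)); exists Phi.
  have sv : distribution_sum integ v D (series_function integ v D).
    by apply: (xgetPex (fun=> 0)); exists (fun x => Phi (- x)); exact: refl_v.
  exact: distribution_sum_unique su (refl_u _ sv) Dx.
have none (w : I -> 'rV[R]_d -> R[i]) : ~ (exists Phi, distribution_sum integ w D Phi) ->
    series_function integ w D = fun=> 0.
  by move=> now; apply: xgetPN => Phi wPhi; apply: now; exists Phi.
rewrite (none u)// (none v)// => -[Psi vPsi]; apply: no_u.
by exists (fun x => Psi (- x)); exact: refl_u.
Qed.

Lemma lame_tensor_reflect (lambda mu_ omega : R)
    (u v : R -> I -> 'rV[R]_d -> R[i]) (sigma : I -> I) x z :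
  (forall f, integ (fun x => f (- x)) = integ f) ->
  involutive sigma -> (forall k l x, v k (sigma l) x = u k l (- x)) ->
  D (x - z) ->
  lame_tensor lambda mu_ omega (fun k => series_function integ (u k) D) x z =
  lame_tensor lambda mu_ omega (fun k => series_function integ (v k) D) z x.
Proof.
move=> integN sigmaK vE Dxz.
have uv k y : D y ->
    series_function integ (u k) D y = series_function integ (v k) D (- y).
  exact: series_function_reflect (vE k).
have hess (k l : R) : hessian (fun y =>
      series_function integ (u k) D y - series_function integ (u l) D y) (x - z) =
    hessian (fun y =>
      series_function integ (v k) D y - series_function integ (v l) D y) (z - x).
  (* Equality at the single point [x - z] would not give equal Hessians; equality on the open set
     [D] does. *)
  rewrite -(opprB x z); apply: (hessian_reflect oD _ Dxz) => y Dy.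
  by rewrite (uv k y Dy) (uv l y Dy).
by rewrite /lame_tensor hess (uv _ _ Dxz) opprB.
Qed.

End Reflection.

(** * The lattices of source points, and the sign change of the parameters *)

Lemma closed_int (R : realType) : closed [set x : R | exists n : int, x = n%:~R].
Proof.
rewrite -[X in closed X]setCK; apply: open_closedC.
rewrite openE => x /= xint.
(* A non-integer [x] lies strictly between its floor and the next integer, and this open interval
   contains no integer. *)
have /andP[fx xf] := floor_itv x.
have {}fx : (Num.floor x)%:~R < x.
  by rewrite lt_neqAle fx andbT; apply/eqP => xE; apply: xint; exists (Num.floor x).
near=> y; move=> [n yE].
have : (Num.floor x)%:~R < (n%:~R : R) < (Num.floor x + 1)%:~R.
  by rewrite -yE; apply/andP; split; near: y;
    [exact: lt_nbhsr|exact: lt_nbhsl].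
by rewrite !ltr_int ltzD1 => /andP[/lt_geF ->].
Unshelve. all: by end_near. Qed.

Lemma closed_coord (R : realType) (d : nat) (j : 'I_d) (A : set R) :
  closed A -> closed [set x : 'rV[R]_d | A (x 0 j)].
Proof. exact: (continuous_closedP _).1 (@coord_continuous _ _ _ 0 j) A. Qed.

Lemma open_setC_lattice2 (R : realType) : open (~` @lattice2 R).
Proof.
apply: closed_openC; apply: closedI.
  exact: (closed_coord (@closed_int R)).
exact: (closed_coord (@closed_eq R 0)).
Qed.

Lemma open_setC_lattice3 (R : realType) : open (~` @lattice3 R).
Proof.
apply: closed_openC; rewrite (_ : @lattice3 R =
  [set x | exists n : int, x 0 0 = n%:~R] `&` [set x | x 0 1 = 0] `&`
  [set x | x 0 ord_max = 0]); last first.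
  by apply/seteqP; split=> x /= [] // [].
apply: closedI; last exact: (closed_coord (@closed_eq R 0)).
apply: closedI; first exact: (closed_coord (@closed_int R)).
exact: (closed_coord (@closed_eq R 0)).
Qed.

Lemma open_setC_bilattice3 (R : realType) : open (~` @bilattice3 R).
Proof.
apply: closed_openC; rewrite (_ : @bilattice3 R =
  [set x | exists n : int, x 0 0 = n%:~R] `&`
  [set x | exists n : int, x 0 1 = n%:~R] `&`
  [set x | x 0 ord_max = 0]); last first.
  by apply/seteqP; split=> x /= [] // [].
apply: closedI; last exact: (closed_coord (@closed_eq R 0)).
apply: closedI; exact: (closed_coord (@closed_int R)).
Qed.

Lemma lattice2N (R : realType) (x : 'rV[R]_2) : lattice2 (- x) -> lattice2 x.
Proof.
rewrite /lattice2 /= !mxE => -[[n xn] /eqP]; rewrite oppr_eq0 => /eqP x1.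
by split=> //; exists (- n); rewrite rmorphN/= -xn opprK.
Qed.

Lemma lattice3N (R : realType) (x : 'rV[R]_3) : lattice3 (- x) -> lattice3 x.
Proof.
rewrite /lattice3 /= !mxE => -[[n xn] /eqP + /eqP].
rewrite !oppr_eq0 => /eqP x1 /eqP x2.
by split=> //; exists (- n); rewrite rmorphN/= -xn opprK.
Qed.

Lemma bilattice3N (R : realType) (x : 'rV[R]_3) :
  bilattice3 (- x) -> bilattice3 x.
Proof.
rewrite /bilattice3 /= !mxE => -[[n xn] [m xm] /eqP]; rewrite oppr_eq0 => /eqP x2.
split=> //; first by exists (- n); rewrite rmorphN/= -xn opprK.
by exists (- m); rewrite rmorphN/= -xm opprK.
Qed.

Lemma alpha_N (R : realType) (alpha : R) (n : int) :
  alpha_ (- alpha) (- n) = - alpha_ alpha n.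
Proof. by rewrite /alpha_ rmorphN/= mulrN opprD. Qed.

Lemma balpha_N (R : realType) (alpha : 'rV[R]_2) (n : int * int) :
  balpha_ (- alpha) (- n.1, - n.2) = - balpha_ alpha n.
Proof.
by apply/rowP => -[[|[|//]] i]; rewrite !mxE /= alpha_N.
Qed.

Lemma sqnormN (R : realType) (d : nat) (x : 'rV[R]_d) : sqnorm (- x) = sqnorm x.
Proof. by apply: eq_bigr => i _; rewrite mxE sqrrN. Qed.

Theorem lemma4p1 (R : realType) (lambda mu omega : R)
  (hmu : 0 < mu) (hlm : 0 < lambda + mu) (homega : 0 < omega) :
  (forall alpha : R, 0 < alpha -> alpha <= k_p lambda mu omega ->
     (forall n : int,
        kappa (k_p lambda mu omega) (alpha_ alpha n ^+ 2) != 0 /\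
        kappa (k_s mu omega) (alpha_ alpha n ^+ 2) != 0) ->
     (forall x z : 'rV[R]_2, ~ @lattice2 R (x - z) ->
        green2 lambda mu omega alpha x z =
        green2 lambda mu omega (- alpha) z x) /\
     (forall x z : 'rV[R]_3, ~ @lattice3 R (x - z) ->
        green3 lambda mu omega alpha x z =
        green3 lambda mu omega (- alpha) z x)) /\
  (forall alpha : 'rV[R]_2, 0 < alpha 0 0 -> 0 < alpha 0 1 ->
     Num.sqrt (sqnorm alpha) <= k_p lambda mu omega ->
     (forall n : int * int,
        kappa (k_p lambda mu omega) (sqnorm (balpha_ alpha n)) != 0 /\
        kappa (k_s mu omega) (sqnorm (balpha_ alpha n)) != 0) ->
     forall x z : 'rV[R]_3, ~ @bilattice3 R (x - z) ->
       bigreen3 lambda mu omega alpha x z =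
       bigreen3 lambda mu omega (- alpha) z x).
Proof.
split=> [alpha _ _ _|alpha _ _ _ _ x z].
  split=> x z.
    apply: (@lame_tensor_reflect R 2 (@integral2 R) int (~` @lattice2 R)
      (fun y => contra_not (@lattice2N R y)) (@open_setC_lattice2 R) _ _ _ _
      (@box_measure2 R) (fun=> erefl) lambda mu omega _ _ -%R).
    - exact: integral2_reflect.
    - exact: opprK.
    (* [kappa] sees only the square of [alpha_], the phase is a product of two factors that both
       change sign, and the transverse variable enters through its absolute value. *)
    - by move=> k n y; rewrite alpha_N sqrrN !mxE mulNr mulrN normrN.
  apply: (@lame_tensor_reflect R 3 (@integral3 R) int (~` @lattice3 R)
    (fun y => contra_not (@lattice3N R y)) (@open_setC_lattice3 R) _ _ _ _
    (@box_measure3 R) (fun=> erefl) lambda mu omega _ _ -%R).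
  - exact: integral3_reflect.
  - exact: opprK.
  (* As in the plane, except that the transverse variables enter through the radius, a function of
     their squares. *)
  - by move=> k n y; rewrite alpha_N sqrrN !mxE mulNr mulrN !sqrrN.
apply: (@lame_tensor_reflect R 3 (@integral3 R) (int * int)%type
  (~` @bilattice3 R)
  (fun y => contra_not (@bilattice3N R y)) (@open_setC_bilattice3 R) _ _ _ _
  (@box_measure3 R) (fun=> erefl) lambda mu omega _ _
  (fun n => (- n.1, - n.2))).
- exact: integral3_reflect.
- by move=> [m n] /=; rewrite !opprK.
(* Here [kappa] depends on the squared norm of [balpha_], and both products in the phase keep their
   value. *)
- move=> k n y /=; rewrite balpha_N sqnormN [(- y) 0 0]mxE [(- y) 0 1]mxE.
  rewrite [(- y) 0 ord_max]mxE [(- balpha_ _ _) 0 0]mxE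
    [(- balpha_ _ _) 0 1]mxE normrN.
  by rewrite !mulNr !mulrN.
Qed.
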